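(* The set of existential $\log$-PA sentences is undecidable; that is, there is no algorithm which, given $n\in\mathbb{N}$ and a quantifier-free $\mathcal{L}_{\log}$-formula $\Phi(x)$ with $x=(x_1,\dots,x_n)$, decides whether the sentence $\exists x\in\mathbb{Z}^n\ \Phi(x)$ is true.
   Context: Let $\mathcal{L}_{\log}=\{<,+,0,1,\log,(\lambda_q)_{q\in\mathbb{Q}}\}$, where $\lambda_q$ is a unary function symbol interpreted in $\mathbb{R}$ as $x\mapsto qx$, and $<,+,0,1$ have their usual interpretation in $\mathbb{R}$. The symbol $\log$ is interpreted as a function $\mathbb{R}\to\mathbb{R}$ that agrees with the natural logarithm on $(0,\infty)$; its values on $(-\infty,0]$ are an arbitrary fixed convention. An existential $\log$-PA sentence is a statement $\exists x\in\mathbb{Z}^n\ \Phi(x)$ with $\Phi$ a quantifier-free $\mathcal{L}_{\log}$-formula; the variables range over integers while the terms are evaluated in $\mathbb{R}$. *)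

(* Defs.v *)
From Stdlib Require Cantor.
From HB Require Import structures.
From mathcomp Require Import all_boot all_order all_algebra.
From mathcomp Require Import all_classical all_reals all_analysis.

Set Implicit Arguments.
Unset Strict Implicit.
Unset Printing Implicit Defensive.

Import Order.TTheory GRing.Theory Num.Theory.

(* Quantifier-free formulas of the language {<, +, 0, 1, log, (lambda_q)_q}
   (with equality, as always in first-order logic) in the variables
   x_0, ..., x_(n-1). *)

Inductive term (n : nat) : Type :=
| TVar of 'I_n
| TZero
| TOne
| TAdd of term n & term n
| TLog of term n
| TScale of rat & term n.

Inductive formula (n : nat) : Type :=
| FLt of term n & term n
| FEq of term n & term n
| FNot of formula n
| FAnd of formula n & formula n
| FOr of formula n & formula n.

Arguments TZero {n}.
Arguments TOne {n}.

Section Semantics.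
Local Open Scope ring_scope.
Variables (R : realType) (lg : R -> R).

Fixpoint teval n (x : 'I_n -> R) (t : term n) : R :=
  match t with
  | TVar i => x i
  | TZero => 0
  | TOne => 1
  | TAdd s t => teval x s + teval x t
  | TLog t => lg (teval x t)
  | TScale q t => ratr q * teval x t
  end.

Fixpoint holds n (x : 'I_n -> R) (F : formula n) : Prop :=
  match F with
  | FLt s t => teval x s < teval x t
  | FEq s t => teval x s = teval x t
  | FNot F => ~ holds x F
  | FAnd F G => holds x F /\ holds x G
  | FOr F G => holds x F \/ holds x G
  end.

Definition sentence_true n (F : formula n) : Prop :=
  exists x : 'I_n -> int, holds (fun i => (x i)%:~R) F.

End Semantics.

(* Goedel numbering: each syntax node is numbered by the Cantor pair of a tag
   for its head symbol and a number for its arguments. *)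

Definition pair_code (a b : nat) : nat := Cantor.to_nat (a, b).

Definition int_code (z : int) : nat :=
  match z with Posz m => m.*2 | Negz m => m.*2.+1 end.

Definition rat_code (q : rat) : nat :=
  pair_code (int_code (numq q)) (int_code (denq q)).

Fixpoint term_code n (t : term n) : nat :=
  match t with
  | TVar i => pair_code 0 i
  | TZero => pair_code 1 0
  | TOne => pair_code 2 0
  | TAdd s t => pair_code 3 (pair_code (term_code s) (term_code t))
  | TLog t => pair_code 4 (term_code t)
  | TScale q t => pair_code 5 (pair_code (rat_code q) (term_code t))
  end.

Fixpoint formula_code n (F : formula n) : nat :=
  match F with
  | FLt s t => pair_code 0 (pair_code (term_code s) (term_code t))
  | FEq s t => pair_code 1 (pair_code (term_code s) (term_code t))
  | FNot F => pair_code 2 (formula_code F)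
  | FAnd F G => pair_code 3 (pair_code (formula_code F) (formula_code G))
  | FOr F G => pair_code 4 (pair_code (formula_code F) (formula_code G))
  end.

Lemma pair_code_inj a b c d :
  pair_code a b = pair_code c d -> a = c /\ b = d.
Proof.
move=> e; have := Cantor.cancel_of_to (a, b).
by rewrite -/(pair_code a b) e /pair_code Cantor.cancel_of_to => -[-> ->].
Qed.

Lemma int_code_inj : injective int_code.
Proof.
case=> m [] k /= e; have := congr1 odd e; rewrite /= ?odd_double //= => _.
  by rewrite (double_inj e).
by case: e => /double_inj ->.
Qed.

Lemma rat_code_inj : injective rat_code.
Proof.
move=> p q /pair_code_inj[/int_code_inj en /int_code_inj ed].
by rewrite -(divq_num_den p) -(divq_num_den q) en ed.
Qed.

Lemma term_code_inj n : injective (@term_code n).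
Proof.
elim=> [i|||s IHs t IHt|t IHt|q t IHt] [j|||s' t'|t'|q' t'] /=;
  move/pair_code_inj=> [//= _].
- by move/val_inj->.
- by move/pair_code_inj=> [/IHs-> /IHt->].
- by move/IHt->.
- by move/pair_code_inj=> [/rat_code_inj-> /IHt->].
Qed.

Lemma formula_code_inj n : injective (@formula_code n).
Proof.
elim=> [s t|s t|F IHF|F IHF G IHG|F IHF G IHG] [s' t'|s' t'|F'|F' G'|F' G'] /=;
  move/pair_code_inj=> [//= _].
- by move/pair_code_inj=> [/term_code_inj-> /term_code_inj->].
- by move/pair_code_inj=> [/term_code_inj-> /term_code_inj->].
- by move/IHF->.
- by move/pair_code_inj=> [/IHF-> /IHG->].
- by move/pair_code_inj=> [/IHF-> /IHG->].
Qed.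

(* Algorithms are Kleene's partial recursive functions: [recfun n] is the type
   of programs of arity n, and [computes f v y] says that f halts on input v
   with output y. *)

Inductive recfun : nat -> Type :=
| RZero n : recfun n
| RSucc : recfun 1
| RProj n : 'I_n -> recfun n
| RComp m n : recfun m -> ('I_m -> recfun n) -> recfun n
| RPrec n : recfun n -> recfun n.+2 -> recfun n.+1
| RMin n : recfun n.+1 -> recfun n.

(* RPrec f g maps (0, v) to f v and (k + 1, v) to g (k, RPrec f g (k, v), v);
   RMin f maps v to the least k such that f (k, v) = 0, all the values
   f (z, v) with z < k being required to be defined. *)
Fixpoint computes n (f : recfun n) : n.-tuple nat -> nat -> Prop :=
  match f in recfun n return n.-tuple nat -> nat -> Prop with
  | RZero _ => fun _ y => y = 0
  | RSucc => fun v y => y = (thead v).+1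
  | RProj _ i => fun v y => y = tnth v i
  | RComp m _ f g => fun v y =>
      exists2 w : m.-tuple nat,
        forall i, computes (g i) v (tnth w i) & computes f w y
  | RPrec _ f g => fun v =>
      let w := [tuple of behead v] in
      (fix iter (k : nat) : nat -> Prop :=
         match k with
         | 0 => computes f w
         | k'.+1 => fun y =>
             exists2 r, iter k' r & computes g [tuple of k' :: r :: w] y
         end) (thead v)
  | RMin _ f => fun v y =>
      computes f [tuple of y :: v] 0 /\
      forall z, z < y -> exists r, computes f [tuple of z :: v] r.+1
  end.

Lemma computes_fun n (f : recfun n) v y z :
  computes f v y -> computes f v z -> y = z.
Proof.
elim: f v y z => {n}
  [n|| n i| m n f IHf g IHg| n f IHf g IHg| n f IHf] v y z /=.
- by move=> -> ->.
- by move=> -> ->.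
- by move=> -> ->.
- move=> [w gw fw] [w' gw' fw'].
  suff ew : w = w' by apply: IHf fw _; rewrite ew.
  by apply: eq_from_tnth => i; apply: IHg (gw i) (gw' i).
- elim: (thead v) y z => [|k IHk] y z; first exact: IHf.
  by move=> [r hr gy] [r' hr' gz]; rewrite (IHk _ _ hr' hr) in gz; apply: IHg gz.
- move=> [fy ly] [fz lz]; case: (ltngtP y z) => // h.
    by have [r /(IHf _ _ _ fy)] := lz _ h.
  by have [r /(IHf _ _ _ fz)] := ly _ h.
Qed.

(* A set P of sentences is decided by an algorithm which, given the number n of
   variables and the code of the matrix F, answers 1 if P holds and 0 if not. *)
Definition decidable_sentences (P : forall n, formula n -> Prop) : Prop :=
  exists f : recfun 2, forall n (F : formula n),
    (P n F -> computes f [tuple n; formula_code F] 1) /\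
    (~ P n F -> computes f [tuple n; formula_code F] 0).

(* Main.v *)
(* Over the positive integers [z = x * y] iff [log z = log x + log y], and for
   [x, z > 1] and [y > 0], [z = x ^ y] iff [log log z = log y + log log x].  So
   every exponential Diophantine relation is expressed by an existential log-PA
   sentence, and the Davis-Putnam-Robinson theorem applies.  By induction on
   programs, with Goedel's beta function, the graph of a partial recursive
   function has the form "exists x, for all k <= x, D(k, x, e)" with D
   Diophantine, and the bounded quantifier is eliminated by the Chinese
   remainder theorem at the price of binomial coefficients and factorials, both
   of which are exponential Diophantine.  A decision algorithm is then refuted
   by diagonalization: let F(a, b) say that the algorithm answers 0 on the
   sentence G(a, b), where G is the formula in a variables with code b; then
   instantiate F at its own number of variables and its own code. *)

Require Import Defs.
From mathcomp Require Import all_boot all_order all_algebra.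
From mathcomp Require Import all_classical all_reals all_analysis.
From mathcomp Require Import zify.

Set Implicit Arguments.
Unset Strict Implicit.
Unset Printing Implicit Defensive.

Import Order.TTheory GRing.Theory Num.Theory.

Local Open Scope nat_scope.

(** * Goedel's beta function *)

(* [T = N!^2] and [m_k = T/(k+1) - 1]: every prime up to [N] divides [T/(k+1)],
   so [m_k] has no small prime factor; moreover [T - 1 = k] modulo [m_k]. *)
Definition godel_base (N : nat) := N`! * N`!.
Definition godel_mod (T k : nat) := T %/ k.+1 - 1.

Section Moduli.
Variable N : nat.
Hypothesis N_ge3 : 3 <= N.
Local Notation T := (godel_base N).

Lemma godel_base_divE k : k < N -> T %/ k.+1 = N`! * (N`! %/ k.+1).
Proof. by move=> kN; rewrite muln_divA // dvdn_fact. Qed.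

Lemma fact_gt2 : 2 < N`!.
Proof. exact: leq_trans N_ge3 (fact_geq N). Qed.

Lemma godel_base_div_gt2 k : k < N -> 2 < T %/ k.+1.
Proof.
move=> kN; rewrite godel_base_divE //; apply: leq_trans fact_gt2 _.
by rewrite leq_pmulr // divn_gt0 // dvdn_leq ?fact_gt0 ?dvdn_fact.
Qed.

Lemma godel_mod_mul k : k < N -> (godel_mod T k).+1 * k.+1 = T.
Proof.
move=> kN; have := godel_base_div_gt2 kN; rewrite /godel_mod => h.
have -> : (T %/ k.+1 - 1).+1 = T %/ k.+1 by lia.
by rewrite divnK // dvdn_mulr // dvdn_fact.
Qed.

Lemma godel_mod_gt1 k : k < N -> 1 < godel_mod T k.
Proof. by move=> /godel_base_div_gt2; rewrite /godel_mod; lia. Qed.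

Lemma godel_mod_prime_gt k p : k < N -> prime p -> p %| godel_mod T k -> N < p.
Proof.
move=> kN pp pm; rewrite ltnNge; apply/negP => pN.
have pT : p %| T %/ k.+1.
  by rewrite godel_base_divE // dvdn_mulr // dvdn_fact // prime_gt0.
have : p %| 1.
  by rewrite -(dvdn_addr _ pm) /godel_mod subnK //; have := godel_base_div_gt2 kN;
    lia.
by rewrite dvdn1 => /eqP p1; rewrite p1 in pp.
Qed.

Lemma godel_mod_gt k : k < N -> N < godel_mod T k.
Proof.
move=> kN; have m1 := godel_mod_gt1 kN.
apply: leq_trans (godel_mod_prime_gt kN (pdiv_prime m1) (pdiv_dvd _)) _.
by rewrite pdiv_leq //; lia.
Qed.

Lemma godel_base_pred_mod k : k < N -> T - 1 = k %[mod godel_mod T k].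
Proof.
move=> kN; have e := godel_mod_mul kN.
have -> : T - 1 = k.+1 * godel_mod T k + k by rewrite -{1}e; lia.
by rewrite modnMDl.
Qed.

(** A common prime factor exceeds [N], and [T - 1] is congruent modulo it to both [i] and [j]; as
    these are below [N], they would coincide. *)
Lemma godel_mod_coprime i j : i < N -> j < N -> i != j ->
  coprime (godel_mod T i) (godel_mod T j).
Proof.
move=> iN jN; apply: contraR => nc.
have : 1 < gcdn (godel_mod T i) (godel_mod T j).
  by move: nc; rewrite /coprime; have := godel_mod_gt1 iN;
    case: (gcdn _ _) (gcdn_gt0 (godel_mod T i) (godel_mod T j)) => [|[]]; lia.
move=> g1; set p := pdiv (gcdn (godel_mod T i) (godel_mod T j)).
have pp : prime p := pdiv_prime g1.
have pg : p %| gcdn (godel_mod T i) (godel_mod T j) := pdiv_dvd _.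
move: (pg); rewrite dvdn_gcd => /andP[pi pj].
have pN := godel_mod_prime_gt iN pp pi.
have ei : T - 1 = i %[mod p].
  by rewrite -(modn_dvdm _ pi) godel_base_pred_mod // modn_dvdm.
have ej : T - 1 = j %[mod p].
  by rewrite -(modn_dvdm _ pj) godel_base_pred_mod // modn_dvdm.
move: ei; rewrite ej (modn_small (ltn_trans iN pN)) (modn_small (ltn_trans jN pN)).
by move=> ->.
Qed.

Lemma coprime_prod_nat (m : nat -> nat) n x :
  (forall i, i < n -> coprime (m i) x) -> coprime (\prod_(i < n) m i) x.
Proof.
move=> h; elim/big_rec: _ => [|i y _ IH]; first by rewrite coprime1n.
by rewrite coprimeMl IH h.
Qed.

Lemma prod_godel_mod_dvd n X : n <= N ->
  (forall k, k < n -> godel_mod T k %| X) -> \prod_(k < n) godel_mod T k %| X.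
Proof.
elim: n => [|n IH] nN h; first by rewrite big_ord0 dvd1n.
rewrite big_ord_recr /= Gauss_dvd ?IH ?h //; try lia.
  by move=> k kn; apply: h; lia.
by apply: coprime_prod_nat => i lin; apply: godel_mod_coprime; lia.
Qed.

(** Since [T - 1 - n = m_n * (n + 1)], passing from [n] to [n + 1] in the binomial coefficient
    multiplies it by exactly [m_n]. A product of variable length thus becomes a single exponential
    Diophantine term. *)
Lemma bin_godel_base n : n <= N -> 'C(T - 1, n) = \prod_(k < n) godel_mod T k.
Proof.
elim: n => [|n IH] nN; first by rewrite big_ord0 bin0.
rewrite big_ord_recr /= -IH; last lia.
have := mul_bin_left (T - 1) n.
have -> : T - 1 - n = godel_mod T n * n.+1.
  by have := godel_mod_mul nN; lia.
by move=> h; apply/eqP; rewrite -(eqn_pmul2l (ltn0Sn n)) h; apply/eqP; lia.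
Qed.

Lemma godel_mod_crt (s : nat -> nat) n : n <= N ->
  exists U, forall k, k < n -> U = s k %[mod godel_mod T k].
Proof.
elim: n => [|n IH] nN; first by exists 0.
have [U hU] : exists U, forall k, k < n -> U = s k %[mod godel_mod T k].
  by apply: IH; lia.
have co : coprime (\prod_(i < n) godel_mod T i) (godel_mod T n).
  by apply: coprime_prod_nat => i lin; apply: godel_mod_coprime; lia.
exists (chinese (\prod_(i < n) godel_mod T i) (godel_mod T n) U (s n)) => k.
rewrite ltnS leq_eqVlt => /orP[/eqP->|kn]; first exact: chinese_modr.
have kd : godel_mod T k %| \prod_(i < n) godel_mod T i.
  by rewrite (bigD1 (Ordinal kn)) //= dvdn_mulr.
by rewrite -hU // -(modn_dvdm _ kd) chinese_modl // modn_dvdm.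
Qed.
End Moduli.

(** The remainder of [c] modulo [T / (i + 1) - 1], phrased with polynomial equations and one
    inequality so that its graph is Diophantine without exponentiation. It is a partial function of
    [i]. *)
Definition godel_beta c T i x :=
  exists m q, [/\ m.+1 * i.+1 = T, x < m & c = q * m + x].

Lemma beta_fun c T i x y : godel_beta c T i x -> godel_beta c T i y -> x = y.
Proof.
move=> [m [q [hm xm ->]]] [m' [q' [hm' ym e]]].
have em : m = m' by apply/eqP; rewrite -eqSS -(eqn_pmul2r (ltn0Sn i)) hm hm'.
subst m'; have := congr1 (modn^~ m) e.
by rewrite /= !modnMDl !modn_small.
Qed.

Lemma beta_ex (s : nat -> nat) n :
  exists c T, forall i, i < n -> godel_beta c T i (s i).
Proof.
(* The sum makes every [s i] smaller than its modulus, which exceeds [N]; the other summands cover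
   the length and the hypothesis [3 <= N]. *)
pose N := n + 3 + \sum_(i < n) s i.
have N3 : 3 <= N by rewrite /N; lia.
have nN : n <= N by rewrite /N; lia.
have [U hU] := godel_mod_crt N3 s nN.
exists U, (godel_base N) => i lin; have iN : i < N by lia.
exists (godel_mod (godel_base N) i), (U %/ godel_mod (godel_base N) i).
have si : s i < godel_mod (godel_base N) i.
  apply: leq_ltn_trans (godel_mod_gt N3 iN).
  by rewrite /N (bigD1 (Ordinal lin)) //=; lia.
split=> //; first exact: godel_mod_mul.
by rewrite {1}(divn_eq U (godel_mod (godel_base N) i)) hU // (modn_small si).
Qed.

(** * Binomial coefficients and factorials through exponentials *)

Lemma sum_digits_lt u (d : nat -> nat) k : (forall i, d i < u) ->
  \sum_(i < k) d i * u ^ i < u ^ k.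
Proof.
move=> du; elim: k => [|k IH]; first by rewrite big_ord0.
rewrite big_ord_recr /= expnS; have := du k => h.
have : (d k).+1 * u ^ k <= u * u ^ k by rewrite leq_mul2r h orbT.
by apply: leq_trans; rewrite mulSn -addSn leq_add2r.
Qed.

Lemma bin_lt_exp n k : 'C(n, k) < (2 ^ n).+1.
Proof.
rewrite ltnS; elim: n k => [|n IH] [|k] //; first by rewrite bin0 expn_gt0.
by rewrite binS expnS; have := IH k; have := IH k.+1; lia.
Qed.

(** By the binomial theorem the coefficients ['C(n, i)] are the digits of [(u + 1) ^ n] in base
    [u = 2 ^ n + 1], a base exceeding all of them; [q] and [r] hold the digits above and below
    position [k]. *)
Lemma bin_expP n k c :
  c = 'C(n, k) <->
  exists q r u, [/\ u = (2 ^ n).+1, u.+1 ^ n = q * u ^ k.+1 + c * u ^ k + r,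
    r < u ^ k & c < u].
Proof.
set u0 := (2 ^ n).+1.
have u0gt : 0 < u0 by [].
have E : exists q r, u0.+1 ^ n = q * u0 ^ k.+1 + 'C(n, k) * u0 ^ k + r /\
  r < u0 ^ k.
  exists (\sum_(i < n) 'C(n, k.+1 + i) * u0 ^ i), (\sum_(i < k) 'C(n, i) * u0 ^ i).
  split; last exact: (sum_digits_lt k (bin_lt_exp n)).
  rewrite -addn1 addnC -[1 + u0]/(1 + u0) expnDn.
  (* Padding with vanishing coefficients lets the sum split at position [k] whether or not
     [k <= n]. *)
  transitivity (\sum_(i < k + (1 + n)) 'C(n, i) * u0 ^ i).
    have -> : \sum_(i < n.+1) 'C(n, i) * (1 ^ (n - i) * u0 ^ i)
            = \sum_(i < n.+1) 'C(n, i) * u0 ^ i.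
      by apply: eq_bigr => i _; rewrite exp1n mul1n.
    rewrite (big_ord_widen (k + (1 + n)) (fun i => 'C(n, i) * u0 ^ i)); last lia.
    rewrite big_mkcond; apply: eq_bigr => i _; case: ltnP => // h.
    by rewrite bin_small.
  rewrite big_split_ord /= big_split_ord /= big_ord1 addn0 big_distrl /=.
  rewrite [RHS]addnC; congr (_ + _); rewrite addnC; congr (_ + _).
  apply: eq_bigr => i _; rewrite addnA addn1 -mulnA -expnD; congr (_ * _ ^ _).
  lia.
split.
  move=> ->; have [q [r [e1 e2]]] := E; exists q, r, u0; split=> //.
  exact: bin_lt_exp.
move=> [q [r [u [-> e2 rk cu]]]]; have [q' [r' [e1 rk']]] := E.
(* Digits are unique: the one at position [k] is recovered by a quotient and a remainder. *)
have G a b x y : a = x * u0 ^ k.+1 + y * u0 ^ k + b -> b < u0 ^ k -> y < u0 ->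
    y = (a %/ u0 ^ k) %% u0.
  move=> -> h1 h2; rewrite expnS mulnA -mulnDl divnMDl ?expn_gt0 //.
  by rewrite (divn_small h1) addn0 modnMDl modn_small.
by rewrite (G _ _ _ _ e2 rk cu) (G _ _ _ _ e1 rk' (bin_lt_exp n k)).
Qed.

(** Lowering the [N] factors of [r ^ N] by [N] one after the other costs at most [N * r ^ N.-1] each
    time. The induction keeps the amount subtracted fixed while the exponent varies. *)
Lemma bernoulli_sub r N : N <= r -> r ^ N <= (r - N) ^ N + N * N * r ^ N.-1.
Proof.
move=> Nr.
have G m : m <= N -> r ^ m <= (r - N) ^ m + m * N * r ^ m.-1.
  elim: m => [|m IH] mN //; have := IH ltac:(lia).
  rewrite !expnS /=; case: m IH mN => [|m] IH mN; first by rewrite !expn0; lia.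
  move: Nr; rewrite /= !expnS.
  move: ((r-N)^m) (r^m) => a b Nr h.
  have a1 : (r - N) * (r * b) <= (r - N) * ((r-N) * a + m.+1 * N * b).
    by rewrite leq_mul2l h orbT.
  have : (r - N) * (m.+1 * N * b) <= r * (m.+1 * N * b)
    by rewrite leq_mul2r leq_subr orbT.
  move: a1; rewrite mulnBl; nia.
exact: G.
Qed.

(** The quotient of the falling factorial [r ^_ N] by ['C(r, N)] is exactly [N!]. For [r] this
    large, replacing [r ^_ N] by [r ^ N] raises the quotient by less than 1. *)
Lemma fact_div_bin N r : (N`!).+1 * (N * N) + N < r -> N`! = r ^ N %/ 'C(r, N).
Proof.
move=> hr; have Nr : N < r by lia.
have C0 : 0 < 'C(r, N) by rewrite bin_gt0; lia.
have ff : 'C(r, N) * N`! = r ^_ N := bin_ffact r N.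
have up : r ^_ N <= r ^ N.
  rewrite ffact_prod -[X in _ <= _ ^ X]card_ord -prod_nat_const.
  by apply: leq_prod => i _; rewrite leq_subr.
have lo : (r - N) ^ N <= r ^_ N.
  rewrite ffact_prod -[X in _ ^ X <= _]card_ord -prod_nat_const.
  by apply: leq_prod => i _; have := ltn_ord i; lia.
apply/esym/eqP; rewrite eqn_leq leq_divRL // -ltnS ltn_divLR //.
apply/andP; split; last by rewrite mulnC ff.
have B := bernoulli_sub (ltnW Nr).
have lt1 : (N`!).+1 * (N * N * r ^ N.-1) < r ^ N.
  case: (N) hr Nr => [|n] hr Nr; first by rewrite mul0n muln0.
  rewrite [X in _ < X]expnS mulnA ltn_mul2r expn_gt0 /=.
  by apply/andP; split; lia.
have : (N`!).+1 * r ^ N < (N`!).+1 * r ^_ N + r ^ N.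
  have : (N`!).+1 * r ^ N <= (N`!).+1 * ((r - N) ^ N + N * N * r ^ N.-1)
    by rewrite leq_mul2l B orbT.
  have : (N`!).+1 * (r - N) ^ N <= (N`!).+1 * r ^_ N by rewrite leq_mul2l lo orbT.
  by rewrite mulnDr; lia.
by rewrite -ff; nia.
Qed.

(** * Exponential Diophantine relations *)

(** Environments are infinite, so shifting and interleaving variables needs no arity bookkeeping. *)
Definition env := nat -> nat.
Definition var := (nat + nat)%type.
Definition assignment (e u : env) (v : var) :=
  match v with inl i => e i | inr j => u j end.

Inductive atom :=
| AOne of var
| AAdd of var & var & var
| AMul of var & var & var
| APow of var & var & var.

Definition atom_holds (s : var -> nat) a :=
  match a with
  | AOne x => s x = 1
  | AAdd x y z => s x + s y = s z
  | AMul x y z => s x * s y = s z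
  | APow x y z => s x ^ s y = s z
  end.

Definition atom_vars a :=
  match a with
  | AOne x => [:: x]
  | AAdd x y z | AMul x y z | APow x y z => [:: x; y; z]
  end.

Definition atom_rename (f : var -> var) a :=
  match a with
  | AOne x => AOne (f x)
  | AAdd x y z => AAdd (f x) (f y) (f z)
  | AMul x y z => AMul (f x) (f y) (f z)
  | APow x y z => APow (f x) (f y) (f z)
  end.

Definition atom_ok (b : bool) a := if a is APow _ _ _ then b else true.

Definition system_holds (s : var -> nat) l :=
  forall a, List.In a l -> atom_holds s a.

Lemma system_holds_rename f s l :
  system_holds s (map (atom_rename f) l) <-> system_holds (s \o f) l.
Proof.
split=> h a ha.
  have := h _ (List.in_map (atom_rename f) _ _ ha); by case: (a).
by have /List.in_map_iff[a' [<- /h]] := ha; case: (a').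
Qed.

Lemma system_holds_cat s l l' :
  system_holds s (l ++ l') <-> system_holds s l /\ system_holds s l'.
Proof.
split=> [h|[h h'] a /List.in_app_iff[/h|/h']//].
by split=> a ha; apply: h; apply/List.in_app_iff; [left|right].
Qed.

Definition system_ok b l := forall a, List.In a l -> atom_ok b a.

Lemma system_ok_rename b f l : system_ok b l -> system_ok b (map (atom_rename f) l).
Proof. by move=> h a /List.in_map_iff[a' [<- /h]]; case: (a'). Qed.

(* Parameters are the variables [inl i], existential unknowns the [inr j]; the
   flag tells whether exponentiation may occur. *)
Definition diophantine b (P : env -> Prop) :=
  exists2 l, system_ok b l &
    forall e, P e <-> exists u, system_holds (assignment e u) l.

(** * Closure properties of Diophantine relations and functions *)

Section Closure.
Variable b : bool.
Local Notation dio := (diophantine b).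

Lemma dio_ext P Q : (forall e, P e <-> Q e) -> dio P -> dio Q.
Proof. by move=> PQ [l lb h]; exists l => // e; rewrite -PQ. Qed.

Lemma dio_true : dio (fun=> True).
Proof. by exists [::] => // e; split=> // _; exists e. Qed.

Definition interleave (u e : env) : env :=
  fun i => if odd i then e i./2 else u i./2.

Lemma interleave_even u e j : interleave u e j.*2 = u j.
Proof. by rewrite /interleave odd_double doubleK. Qed.

Lemma interleave_odd u e j : interleave u e j.*2.+1 = e j.
Proof. by rewrite /interleave /= odd_double /= uphalf_double. Qed.

Lemma dio_and P Q : dio P -> dio Q -> dio (fun e => P e /\ Q e).
Proof.
move=> [l lb hP] [m mb hQ].
pose f (v : var) : var := match v with inl i => inl i | inr j => inr j.*2 end.
pose g (v : var) : var := match v with inl i => inl i | inr j => inr j.*2.+1 end.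
exists (map (atom_rename f) l ++ map (atom_rename g) m).
  by move=> a /List.in_app_iff[]; [move: a; exact: system_ok_rename|
    move: a; exact: system_ok_rename].
move=> e; rewrite hP hQ.
have fE u w : assignment e (interleave u w) \o f = assignment e u.
  by apply: funext => -[i|j] //=; rewrite interleave_even.
have gE u w : assignment e (interleave u w) \o g = assignment e w.
  by apply: funext => -[i|j] //=; rewrite interleave_odd.
split=> [[[u hu] [w hw]]|[u]].
  by exists (interleave u w); rewrite system_holds_cat !system_holds_rename fE gE.
have -> : u = interleave (fun j => u j.*2) (fun j => u j.*2.+1).
  apply: funext => i; rewrite /interleave.
  by case: ifP => oi; rewrite -[in LHS](odd_double_half i) oi.
rewrite system_holds_cat !system_holds_rename fE gE => -[h1 h2].
by split; [exists (fun j => u j.*2)|exists (fun j => u j.*2.+1)].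
Qed.

Lemma dio_rename (r : nat -> nat) P : dio P -> dio (fun e => P (e \o r)).
Proof.
move=> [l lb hP].
pose f (v : var) : var := match v with inl i => inl (r i) | inr j => inr j end.
exists (map (atom_rename f) l); first exact: system_ok_rename.
move=> e; rewrite hP.
have fE u : assignment e u \o f = assignment (e \o r) u by apply: funext => -[].
by split=> -[u hu]; exists u; move: hu; rewrite system_holds_rename fE.
Qed.

(** Quantifies over a whole environment at once: even parameters become unknowns with even index,
    and the former unknowns move to the odd indices. *)
Lemma dio_exs P : dio P -> dio (fun e => exists u, P (interleave u e)).
Proof.
move=> [l lb hP].
pose f (v : var) : var := match v with
  | inl i => if odd i then inl i./2 else inr i./2.*2 | inr j => inr j.*2.+1 end.
exists (map (atom_rename f) l); first exact: system_ok_rename.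
move=> e.
have fE u w : assignment e (interleave u w) \o f = assignment (interleave u e) w.
  apply: funext => -[i|j] /=; last by rewrite interleave_odd.
  by rewrite [in RHS]/interleave; case: ifP => //= _; rewrite interleave_even.
split=> [[u]|[u]].
  rewrite hP => -[w hw].
  by exists (interleave u w); rewrite system_holds_rename fE.
have -> : u = interleave (fun j => u j.*2) (fun j => u j.*2.+1).
  apply: funext => i; rewrite /interleave.
  by case: ifP => oi; rewrite -[in LHS](odd_double_half i) oi.
rewrite system_holds_rename fE => h.
by exists (fun j => u j.*2); rewrite hP; exists (fun j => u j.*2.+1).
Qed.

(** De Bruijn convention: the bound variable is read at index 0 and the outer variables are shifted
    by one. *)
Lemma dio_ex (P : env -> nat -> Prop) :
  dio (fun e => P (fun i => e i.+1) (e 0)) -> dio (fun e => exists x, P e x).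
Proof.
move=> h; pose r i := if i is i'.+1 then i'.*2.+1 else 0.
apply: dio_ext (dio_exs (dio_rename r h)) => e.
have rE u : (fun i => interleave u e (r i.+1)) = e by apply: funext => i;
  rewrite interleave_odd.
split=> [[u /=]|[x hx]]; first by rewrite rE; exists (interleave u e 0).
by exists (fun=> x); rewrite /= rE.
Qed.

(* The value sits at index 0, the arguments of [f] are shifted by one. *)
Definition dio_fun (f : env -> nat) := dio (fun e => f (fun i => e i.+1) = e 0).

Lemma dio_eq_var i j : dio (fun e => e i = e j).
Proof.
(* Equality is not an atom: the first equation forces the unknown to be 0, and the second adds it to
   [e i]. *)
exists [:: AAdd (inr 0) (inr 0) (inr 0); AAdd (inl i) (inr 0) (inl j)].
  by move=> a [<-|[<-|[]]].
move=> e; split=> [ij|[u h]].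
  by exists (fun=> 0) => a [<-|[<-|[]]] //=; rewrite addn0.
have /= h1 := h _ (or_introl (erefl _)).
have /= h2 := h _ (or_intror (or_introl (erefl _))); lia.
Qed.

Lemma dio_funV i : dio_fun (fun e => e i).
Proof. exact: dio_eq_var. Qed.

Lemma dio_fun_ext f g : f =1 g -> dio_fun f -> dio_fun g.
Proof. by move=> fg; apply: dio_ext => e; rewrite fg. Qed.

Lemma dio_let f (P : env -> nat -> Prop) : dio_fun f ->
  dio (fun e => P (fun i => e i.+1) (e 0)) -> dio (fun e => P e (f e)).
Proof.
move=> hf hP; apply: (@dio_ext (fun e => exists x, f e = x /\ P e x)).
  by move=> e; split=> [[x [<-]]//|h]; exists (f e).
by apply: dio_ex; apply: dio_and hf hP.
Qed.

Lemma dio_fun_let f (g : env -> nat -> nat) : dio_fun f ->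
  dio_fun (fun e => g (fun i => e i.+1) (e 0)) -> dio_fun (fun e => g e (f e)).
Proof.
move=> hf hg.
apply: (@dio_let (fun e => f (fun i => e i.+1))
   (fun e x => g (fun i => e i.+1) x = e 0)).
  exact: (dio_rename (fun i => if i is i'.+1 then i'.+2 else 0) hf).
exact: (dio_rename (fun i => match i with 0 => 1 | 1 => 0 | i'.+2 => i'.+2 end) hg).
Qed.

Lemma dio_rel2 (Q : nat -> nat -> Prop) f g : dio (fun e => Q (e 0) (e 1)) ->
  dio_fun f -> dio_fun g -> dio (fun e => Q (f e) (g e)).
Proof.
move=> hQ hf hg; apply: (dio_let (P := fun e x => Q x (g e)) hf).
apply: (@dio_let (fun e => g (fun i => e i.+1)) (fun e y => Q (e 0) y)).
  exact: (dio_rename (fun i => if i is i'.+1 then i'.+2 else 0) hg).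
exact: (dio_rename (fun i => match i with 0 => 1 | 1 => 0 | i'.+2 => i'.+2 end) hQ).
Qed.

Lemma dio_fun2 (h : nat -> nat -> nat) f g : dio_fun (fun e => h (e 0) (e 1)) ->
  dio_fun f -> dio_fun g -> dio_fun (fun e => h (f e) (g e)).
Proof.
move=> hh hf hg; apply: (@dio_fun_let f (fun e x => h x (g e))) => //.
apply: (@dio_fun_let (fun e => g (fun i => e i.+1)) (fun e y => h (e 0) y)).
  exact: (dio_rename (fun i => if i is i'.+1 then i'.+2 else 0) hg).
exact: (dio_rename (fun i => match i with 0 => 0 | 1 => 2 | 2 => 1 | i'.+3 =>
  i'.+3 end) hh).
Qed.

Lemma dio_eq f g : dio_fun f -> dio_fun g -> dio (fun e => f e = g e).
Proof. by apply: dio_rel2; apply: dio_eq_var. Qed.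

Lemma dio_fun1 : dio_fun (fun=> 1).
Proof.
exists [:: AOne (inl 0)]; first by move=> a [<-|[]].
move=> e; split=> [h|[u h]]; first by exists (fun=> 0) => a [<-|[]] /=.
by have /= := h _ (or_introl (erefl _)).
Qed.

Lemma dio_funD f g : dio_fun f -> dio_fun g -> dio_fun (fun e => f e + g e).
Proof.
apply: dio_fun2; exists [:: AAdd (inl 1) (inl 2) (inl 0)].
  by move=> a [<-|[]].
move=> e; split=> [h|[u h]]; first by exists (fun=> 0) => a [<-|[]] /=.
by have /= := h _ (or_introl (erefl _)).
Qed.

Lemma dio_funM f g : dio_fun f -> dio_fun g -> dio_fun (fun e => f e * g e).
Proof.
apply: dio_fun2; exists [:: AMul (inl 1) (inl 2) (inl 0)].
  by move=> a [<-|[]].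
move=> e; split=> [h|[u h]]; first by exists (fun=> 0) => a [<-|[]] /=.
by have /= := h _ (or_introl (erefl _)).
Qed.

Lemma dio_funS f : dio_fun f -> dio_fun (fun e => (f e).+1).
Proof.
move=> hf; apply: (dio_fun_ext _ (dio_funD hf dio_fun1)) => e; exact: addn1.
Qed.

Lemma dio_funC c : dio_fun (fun=> c).
Proof.
elim: c => [|c IH]; last exact: dio_funS IH.
exists [:: AAdd (inl 0) (inl 0) (inl 0)]; first by move=> a [<-|[]].
move=> e; split=> [h|[u h]]; first by exists (fun=> 0) => a [<-|[]] /=; lia.
by have /= := h _ (or_introl (erefl _)); lia.
Qed.

Lemma dio_le f g : dio_fun f -> dio_fun g -> dio (fun e => f e <= g e).
Proof.
apply: (dio_rel2 (Q := fun x y => x <= y)).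
apply: (@dio_ext (fun e => exists d, e 0 + d = e 1)).
  by move=> e; split=> [[d]|h]; [lia|exists (e 1 - e 0); lia].
by apply: dio_ex; apply: dio_eq (dio_funD _ _) _; apply: dio_funV.
Qed.

Lemma dio_lt f g : dio_fun f -> dio_fun g -> dio (fun e => f e < g e).
Proof. by move=> /dio_funS; apply: dio_le. Qed.

Lemma dio_all_in (T : Type) (l : seq T) (P : T -> env -> Prop) :
  (forall a, List.In a l -> dio (P a)) ->
  dio (fun e => forall a, List.In a l -> P a e).
Proof.
elim: l => [|a l IH] h; first by apply: dio_ext dio_true => e; split.
apply: dio_ext (dio_and (h a (or_introl (erefl _))) (IH _)) => [e|c cl].
  split=> [[h1 h2] c [<-//|/h2//]|h1].
  by split=> [|c cl]; apply: h1; [left|right].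
by apply: h; right.
Qed.

End Closure.

Lemma dio_funX f g : dio_fun true f -> dio_fun true g ->
  dio_fun true (fun e => f e ^ g e).
Proof.
apply: dio_fun2; exists [:: APow (inl 1) (inl 2) (inl 0)].
  by move=> a [<-|[]].
move=> e; split=> [h|[u h]]; first by exists (fun=> 0) => a [<-|[]] /=.
by have /= := h _ (or_introl (erefl _)).
Qed.

Ltac dio := repeat
  match goal with
  | |- dio_fun _ _ => first [ apply: dio_funV | apply: dio_funC | apply: dio_funS
      | apply: dio_funD | apply: dio_funM | apply: dio_funX ]
  | |- diophantine _ (fun e => @?P e /\ @?Q e) => apply: dio_and
  | |- diophantine _ (fun e => exists x, @?P e x) => apply: dio_ex => /=
  | |- diophantine _ (fun e => @?f e = @?g e) => apply: dio_eq
  | |- diophantine _ (fun e => is_true (@?f e < @?g e)) => apply: dio_lt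
  | |- diophantine _ (fun e => is_true (@?f e <= @?g e)) => apply: dio_le
  end.

(* [a = b] is guarded by [f] as [f * a = f * b], so no disjunction of equations
   is needed. *)
Lemma dio_guard P f : diophantine false P -> dio_fun false f ->
  diophantine false (fun e => f e = 0 \/ P e).
Proof.
move=> [l lb hP] hf.
apply: (@dio_ext _ (fun e => exists u, forall a, List.In a l ->
    f (fun i => interleave u e i.*2.+1) = 0 \/
    atom_holds (assignment (fun i => interleave u e i.*2.+1) (fun i =>
      interleave u e i.*2)) a)).
  move=> e; rewrite hP.
  have E u : (fun i => interleave u e i.*2.+1) = e by apply: funext=> i;
    rewrite interleave_odd.
  have E' u : (fun i => interleave u e i.*2) = u by apply: funext=> i;
    rewrite interleave_even.
  split=> [[u h]|[f0|[u h]]].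
  - have [f0|f0] := eqVneq (f e) 0; [by left|right; exists u => a /h].
    by rewrite E E' => -[fe|//]; rewrite fe in f0.
  - by exists e => a _; rewrite E; left.
  - by exists u => a /h; rewrite E E'; right.
apply: (dio_exs (P := fun e' => forall a, List.In a l ->
    f (fun i => e' i.*2.+1) = 0 \/
    atom_holds (assignment (fun i => e' i.*2.+1) (fun i => e' i.*2)) a)).
apply: dio_all_in => a al.
have hg : dio_fun false (fun e => f (fun i => e i.*2.+1)).
  exact: (dio_rename (fun i => if i is i'.+1 then i'.*2.+2 else 0) hf).
pose w (v : var) := match v with inl i => i.*2.+1 | inr j => j.*2 end.
have wE e v : assignment (fun i => e i.*2.+1) (fun i =>
  e i.*2) v = e (w v) by case: v.
have mul_eq0 c x y : c = 0 \/ x = y <-> c * x = c * y.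
  split=> [[->//|->//]|/eqP]; rewrite eqn_mul2l => /orP[/eqP|/eqP]; tauto.
move/lb: al; case: a => //= [x|x y z|x y z] _.
- apply: dio_ext (dio_eq (dio_funM hg (dio_funV _ (w x)))
    (dio_funM hg (dio_funC _ 1))) => e.
  by rewrite wE mul_eq0.
- apply: dio_ext (dio_eq (dio_funM hg (dio_funD (dio_funV _ (w x))
    (dio_funV _ (w y))))
    (dio_funM hg (dio_funV _ (w z)))) => e.
  by rewrite !wE mul_eq0.
- apply: dio_ext (dio_eq (dio_funM hg (dio_funM (dio_funV _ (w x))
    (dio_funV _ (w y))))
    (dio_funM hg (dio_funV _ (w z)))) => e.
  by rewrite !wE mul_eq0.
Qed.

(** In [f + d = g + 1 + s], taking [d = 0] asserts [g < f], while a nonzero [d] leaves [f] and [g]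
    free but makes the guard require [P]. *)
Lemma dio_imp_le P f g : diophantine false P -> dio_fun false f ->
  dio_fun false g ->
  diophantine false (fun e => f e <= g e -> P e).
Proof.
move=> hP hf hg.
apply: (@dio_ext _ (fun e => exists d s, f e + d = (g e).+1 + s /\ (d = 0 \/ P e))).
  move=> e; split=> [[d [s [h [d0|//]]]]|h]; first by move=> fg; exfalso; lia.
  case: (leqP (f e) (g e)) => fg.
    by exists ((g e).+1 - f e), 0; split; [lia|right; apply: h].
  by exists 0, (f e - (g e).+1); split; [lia|left].
pose r2 i := if i is i'.+1 then i'.+3 else 0.
have hf2 := dio_rename r2 hf; have hg2 := dio_rename r2 hg.
do 2![apply: dio_ex => /=]; apply: dio_and.
  by apply: dio_eq (dio_funD hf2 _) (dio_funD (dio_funS hg2) _); dio.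
apply: (dio_guard (f := fun e => e 1)); last by dio.
exact: (dio_rename (fun i => i.+2) hP).
Qed.

(** * Davis normal form *)

(* Davis normal form: a single bounded universal quantifier in front of a
   relation that is Diophantine without exponentiation. *)
Definition davis (P : env -> Prop) :=
  exists2 D : nat -> nat -> env -> Prop,
    diophantine false (fun e => D (e 0) (e 1) (fun i => e i.+2)) &
    forall e, P e <-> exists x, forall k, k <= x -> D k x e.

(** A polynomial pairing that is injective and dominates both components. It packs several numbers
    into the bound of a Davis normal form, from which each instance [k] recovers the same
    numbers. *)
Definition square_pair x y := (x + y) * (x + y) + x.

Lemma square_pair_inj x y x' y' :
  square_pair x y = square_pair x' y' -> x = x' /\ y = y'.
Proof.
rewrite /square_pair => h.
have : x + y = x' + y' by nia.
by move=> s; split; nia.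
Qed.

Lemma davis_ext P Q : (forall e, P e <-> Q e) -> davis P -> davis Q.
Proof. by move=> PQ [D hD h]; exists D => // e; rewrite -PQ. Qed.

Lemma davis_dio P : diophantine false P -> davis P.
Proof.
move=> h; exists (fun _ _ e => P e); first exact: (dio_rename (fun i => i.+2) h).
by move=> e; split=> [he|[x /(_ 0 (leq0n _))]]; first by exists 0.
Qed.

Lemma davis_rename r P : davis P -> davis (fun e => P (e \o r)).
Proof.
move=> [D hD h]; exists (fun k x e => D k x (e \o r)) => [|e]; last by rewrite h.
exact: (dio_rename (fun i => if i is i'.+2 then (r i').+2 else i) hD).
Qed.

(** The two bounds are packed into one larger bound [z]; each matrix is guarded by its own bound,
    and injectivity of the pairing makes the unpacked values independent of [k]. *)
Lemma davis_and P Q : davis P -> davis Q -> davis (fun e => P e /\ Q e).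
Proof.
move=> [D hD hP] [E hE hQ].
exists (fun k z e => exists x y, z = square_pair x y /\
  ((k <= x -> D k x e) /\ (k <= y -> E k y e))).
  do 2![apply: dio_ex => /=]; apply: dio_and; first by rewrite /square_pair; dio.
  apply: dio_and.
    apply: (dio_imp_le (f := fun e => e 2) (g := fun e => e 1)); dio.
    exact: (dio_rename (fun i => match i with 0 => 2 | 1 => 1 | i'.+2 =>
      i'.+4 end) hD).
  apply: (dio_imp_le (f := fun e => e 2) (g := fun e => e 0)); dio.
  exact: (dio_rename (fun i => match i with 0 => 2 | 1 => 0 | i'.+2 =>
    i'.+4 end) hE).
move=> e; rewrite hP hQ; split=> [[[x hx] [y hy]]|[z hz]].
  by exists (square_pair x y) => k _; exists x, y; split=> //; split;
    [apply: hx|apply: hy].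
have [x [y [ez _]]] := hz 0 (leq0n _).
split; [exists x|exists y] => k hk.
  have [|x' [y' [ez' [h _]]]] := hz k; first by rewrite ez /square_pair; nia.
  by move: ez'; rewrite ez => /square_pair_inj[ex _]; rewrite ex; apply: h;
    rewrite -ex.
have [|x' [y' [ez' [_ h]]]] := hz k; first by rewrite ez /square_pair; nia.
by move: ez'; rewrite ez => /square_pair_inj[_ ey]; rewrite ey; apply: h;
  rewrite -ey.
Qed.

Lemma eq_iff (P Q : Prop) : P = Q -> P <-> Q.
Proof. by move->. Qed.

Definition scons x (e : env) : env := fun i => if i is i'.+1 then e i' else x.

(** The witness must not depend on [k], so it is packed with the bound itself. *)
Lemma davis_ex (P : env -> nat -> Prop) :
  davis (fun e => P (fun i => e i.+1) (e 0)) -> davis (fun e => exists x, P e x).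
Proof.
move=> [D hD hP].
exists (fun k z e => exists x y, z = square_pair x y /\ (k <= x ->
  D k x (scons y e))).
  do 2![apply: dio_ex => /=]; apply: dio_and; first by rewrite /square_pair; dio.
  apply: (dio_imp_le (f := fun e => e 2) (g := fun e => e 1)); dio.
  apply: dio_ext (dio_rename (fun i => match i with 0 => 2 | 1 => 1 | 2 => 0
    | i'.+3 => i'.+4 end) hD) => e /=.
  by apply: eq_iff; congr (D _ _ _); apply: funext => -[].
have hP' e y : P e y <-> exists x, forall k, k <= x -> D k x (scons y e).
  exact: (hP (scons y e)).
move=> e; split=> [[y /hP'[x hx]]|[z hz]].
  by exists (square_pair x y) => k _; exists x, y; split=> //; apply: hx.
have [x [y [ez _]]] := hz 0 (leq0n _).
exists y; apply/hP'; exists x => k hk.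
have [|x' [y' [ez' h]]] := hz k; first by rewrite ez /square_pair; nia.
move: ez'; rewrite ez => /square_pair_inj[ex ey].
by rewrite ex ey; apply: h; rewrite -ex.
Qed.

Lemma davis_all_dio (E : nat -> env -> Prop) f :
  diophantine false (fun e => E (e 0) (fun i => e i.+1)) -> dio_fun false f ->
  davis (fun e => forall k, k <= f e -> E k e).
Proof.
(* The equation pins the bound to [f e]; it is always available from the instance [k = 0]. *)
move=> hE hf; exists (fun k x e => f e = x /\ E k e).
  apply: dio_and.
    exact: (dio_rename (fun i => if i is i'.+1 then i'.+2 else 1) hf).
  exact: (dio_rename (fun i => if i is i'.+1 then i'.+2 else 0) hE).
move=> e; split=> [h|[x h] k].
  by exists (f e) => k /h.
by case: (h 0 (leq0n _)) => -> _ /h[].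
Qed.

Lemma dio_beta f g h k : dio_fun false f -> dio_fun false g -> dio_fun false h ->
  dio_fun false k -> diophantine false (fun e =>
    godel_beta (f e) (g e) (h e) (k e)).
Proof.
move=> hf hg hh hk.
pose r i := if i is i'.+1 then i'.+3 else 0.
have hf2 := dio_rename r hf; have hg2 := dio_rename r hg.
have hh2 := dio_rename r hh; have hk2 := dio_rename r hk.
apply: (@dio_ext _ (fun e => exists m q, m.+1 * (h e).+1 = g e /\
   (k e < m /\ f e = q * m + k e))).
  by move=> e; split=> -[m [q]]; [case=> ? []|case]; exists m, q.
do 2![apply: dio_ex => /=].
apply: dio_and; first by apply: (dio_eq (dio_funM _ (dio_funS hh2)) hg2); dio.
apply: dio_and; first by apply: (dio_lt hk2); dio.
by apply: (dio_eq hf2 (dio_funD _ hk2)); dio.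
Qed.

(** The bounds [x] chosen for the various [i] are coded by the beta function and majorized by [Y];
    the two bounded quantifiers over [i] and [k] then merge into one over [K = i * (Y + 1) + k]. *)
Lemma davis_all (Q : env -> nat -> Prop) j :
  davis (fun e => Q (fun i => e i.+1) (e 0)) ->
  davis (fun e => forall i, i < e j -> Q e i).
Proof.
move=> [D hD hQ].
have {}hQ e i : Q e i <-> exists x, forall k, k <= x -> D k x (scons i e).
  exact: (hQ (scons i e)).
(* The bound is inclusive, so the last [K] has quotient [e j]; the guard [i.+1 <= e j] exempts
   it. *)
apply: (@davis_ext (fun e => exists Y c T, forall K, K <= e j * Y.+1 ->
  exists i k x, K = i * Y.+1 + k /\ (k <= Y /\ (i.+1 <= e j ->
    x <= Y /\ (godel_beta c T i x /\ (k <= x -> D k x (scons i e))))))).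
  move=> e; split=> [[Y [c [T h]]] i ij|].
    have [|i0 [k0 [x [eK [k0Y /(_ _)]]]]] := h (i * Y.+1); first by nia.
    have ei0 : i = i0 by nia.
    subst i0 => /(_ ij) [xY [bx _]].
    apply/hQ; exists x => k kx.
    (* Uniqueness of division identifies [i] and [k], and functionality of beta identifies [x1] with
       the [x] found at [k = 0]. *)
    have [|i1 [k1 [x1 [eK1 [k1Y /(_ _)]]]]] := h (i * Y.+1 + k); first by nia.
    have ei1 : i = i1 by nia.
    have ek1 : k = k1 by nia.
    subst i1 k1 => /(_ ij) [_ [bx1]].
    by rewrite (beta_fun bx1 bx); apply.
  move=> h.
  have : forall i, exists x, i < e j -> forall k, k <= x -> D k x (scons i e).
    move=> i; case: (ltnP i (e j)) => [/h/hQ[x hx]|_]; last by exists 0.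
    by exists x.
  move=> /choice[s hs].
  have [c [T hb]] := beta_ex s (e j).
  pose Y := \max_(i < e j) s i.
  exists Y, c, T => K _; exists (K %/ Y.+1), (K %% Y.+1), (s (K %/ Y.+1)).
  split; first exact: divn_eq.
  split; first by rewrite -ltnS ltn_pmod.
  move=> lt; split; first exact: (leq_bigmax (Ordinal lt)).
  by split; [exact: hb|exact: hs].
do 3![apply: davis_ex => /=].
apply: (davis_all_dio (E :=
  fun K e => exists i k x, K = i * (e 2).+1 + k /\ (k <= e 2 /\
   (i.+1 <= e j.+3 -> x <= e 2 /\ (godel_beta (e 1) (e 0) i x /\
     (k <= x -> D k x (scons i (fun l => e l.+3))))))) (f :=
       fun e => e j.+3 * (e 2).+1)).
  do 3![apply: dio_ex => /=]; apply: dio_and; first by dio.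
  apply: dio_and; first by dio.
  apply: dio_imp_le; dio.
    by apply: dio_beta; dio.
  apply: dio_imp_le; dio.
  apply: dio_ext (dio_rename (fun i => match i with 0 => 1 | 1 => 0 | 2 => 2
    | i'.+3 => i'.+3.+4 end) hD) => e /=.
  by apply: eq_iff; congr (D _ _ _); apply: funext => -[].
by dio.
Qed.

(** * Graphs of partial recursive functions *)

Lemma davis_all_in (T : eqType) (s : seq T) (P : T -> env -> Prop) :
  (forall i, davis (P i)) -> davis (fun e => forall i, i \in s -> P i e).
Proof.
move=> h; elim: s => [|a s IH].
  by apply: davis_ext (davis_dio (dio_true _)) => e; split.
apply: davis_ext (davis_and (h a) IH) => e; split.
  by move=> [h1 h2] i; rewrite inE => /orP[/eqP->|/h2].
by move=> h1; split=> [|i si]; apply: h1; rewrite inE ?eqxx ?si ?orbT.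
Qed.

Definition args n (e : env) : n.-tuple nat := [tuple e i | i < n].
Arguments args : clear implicits.

Lemma argsS n e : args n.+1 e = [tuple of e 0 :: args n (fun i => e i.+1)].
Proof.
apply: eq_from_tnth => i; rewrite tnth_mktuple.
case: (unliftP ord0 i) => [j ->|->]; last by rewrite tnth0.
by rewrite tnthS tnth_mktuple.
Qed.

Lemma thead_args n e : thead (args n.+1 e) = e 0.
Proof. by rewrite argsS theadE. Qed.

Lemma behead_args n e : [tuple of behead (args n.+1 e)] = args n (fun i => e i.+1).
Proof. by apply: val_inj; rewrite argsS. Qed.

(** Serves for the intermediate values of a composition: the bound tuple occupies the first [m]
    indices. *)
Lemma davis_ex_tuple m (P : env -> m.-tuple nat -> Prop) :
  davis (fun e => P (fun i => e (m + i)) (args m e)) ->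
  davis (fun e => exists w, P e w).
Proof.
elim: m P => [|m IH] P h.
  apply: davis_ext h => e; split=> [|[w]]; first by exists (args 0 e).
  by rewrite (tuple0 w) (tuple0 (args 0 e)).
apply: (@davis_ext (fun e => exists (w : m.-tuple nat) x, P e [tuple of x :: w])).
  move=> e; split=> [[w [x hw]]|[w hw]]; first by exists [tuple of x :: w].
  by exists [tuple of behead w], (thead w); rewrite -(tuple_eta w).
apply: IH; apply: davis_ex => /=.
by apply: davis_ext h => e; rewrite argsS.
Qed.

Definition davis_graph n (f : recfun n) :=
  davis (fun e => computes f (args n (fun i => e i.+1)) (e 0)).

Lemma davis_graph_args n (f : recfun n) (r : nat -> nat) j :
  davis_graph f -> davis (fun e => computes f (args n (e \o r)) (e j)).
Proof. exact: (davis_rename (fun i => if i is i'.+1 then r i' else j)). Qed.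

(** Gives a name to the anonymous fixpoint inside [computes], to which it is convertible. *)
Definition prim_iter (A : nat -> Prop) (G : nat -> nat -> nat -> Prop) :=
  fix iter (k : nat) : nat -> Prop :=
    match k with
    | 0 => A
    | k'.+1 => fun y => exists2 r, iter k' r & G k' r y
    end.

Lemma prim_iterP A G k y :
  prim_iter A G k y <-> exists s : nat -> nat,
    [/\ A (s 0), forall i, i < k -> G i (s i) (s i.+1) & s k = y].
Proof.
elim: k y => [|k IH] y /=; first by split=> [h|[s [h _ <-]]//]; exists (fun=> y).
split=> [[r /IH[s [s0 hs sk]] gy]|[s [s0 hs sk]]].
  exists (fun i => if i <= k then s i else y); split=> //; last by rewrite ltnn.
  move=> i; rewrite ltnS => ik; rewrite ik; case: ltnP => [ik'|ki]; first exact: hs.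
  by have -> : i = k by [apply/eqP; rewrite eqn_leq ik]; rewrite sk.
exists (s k); first by apply/IH; exists s; split=> // i ik; apply: hs; apply: ltnW.
by rewrite -sk; apply: hs.
Qed.

(** The history of the recursion is coded by a pair [c], [T], leaving a bounded quantifier over its
    steps. *)
Lemma prim_iter_beta A G k y :
  prim_iter A G k y <-> exists c T, (exists x, godel_beta c T 0 x /\ A x) /\
    (godel_beta c T k y /\ forall i, i < k ->
      exists x x', godel_beta c T i x /\ (godel_beta c T i.+1 x' /\ G i x x')).
Proof.
rewrite prim_iterP; split=> [[s [s0 hs <-]]|[c [T [[x0 [b0 Ax0]] [bk h]]]]].
  have [c [T hb]] := beta_ex s k.+1.
  exists c, T; split; first by exists (s 0); split=> //; apply: hb.
  split; first exact: hb.
  move=> i ik; exists (s i), (s i.+1); split; first by apply: hb; apply: ltnW.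
  by split; [apply: hb|apply: hs].
(* The history is decoded by choice, with default 0 where beta has no value. *)
have : forall i, exists x, forall x', godel_beta c T i x' -> x = x'.
  move=> i; have [[x hx]|nx] := pselect (exists x, godel_beta c T i x).
    by exists x => x'; apply: beta_fun hx.
  by exists 0 => x' hx'; case: nx; exists x'.
move=> /choice[s hs]; exists s; split.
- by rewrite (hs _ _ b0).
- by move=> i /h[x [x' [bi [bi' g]]]]; rewrite (hs _ _ bi) (hs _ _ bi').
- exact: hs.
Qed.

Lemma computes_precE n (f : recfun n) g v y :
  computes (RPrec f g) v y <->
  prim_iter (computes f [tuple of behead v])
    (fun k r => computes g [tuple of k :: r :: [tuple of behead v]]) (thead v) y.
Proof. by []. Qed.

(** Composition needs a tuple of witnesses; primitive recursion and minimization both come down to a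
    bounded quantifier, handled by [davis_all]. *)
Lemma recfun_davis n (f : recfun n) : davis_graph f.
Proof.
elim: f => {n}
  [n|| n i| m n f IHf g IHg| n f IHf g IHg| n f IHf]; rewrite /davis_graph.
- by apply: davis_dio => /=; dio.
- apply: davis_dio; apply: (@dio_ext _ (fun e => e 0 = (e 1).+1)); last by dio.
  by move=> e /=; rewrite thead_args.
- apply: davis_dio; apply: (@dio_ext _ (fun e => e 0 = e i.+1)); last by dio.
  by move=> e /=; rewrite tnth_mktuple.
- apply: (@davis_ext (fun e => exists w, (forall i, i \in enum 'I_m ->
      computes (g i) (args n (fun l => e l.+1)) (tnth w i)) /\ computes f w (e 0))).
    move=> e; split=> -[w]; first by move=> [h1 h2]; exists w => // i; apply: h1;
      rewrite mem_enum.
    by move=> h1 h2; exists w; split=> // i _; apply: h1.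
  apply: davis_ex_tuple; apply: davis_and.
    apply: davis_all_in => i.
    apply: davis_ext (davis_graph_args (fun l => m + l.+1) i (IHg i)) => e.
    rewrite tnth_mktuple. exact: iff_refl.
  exact: (davis_graph_args (fun l => l) (m + 0) IHf).
- apply: (@davis_ext (fun e => prim_iter
      (computes f (args n (fun l => e l.+2)))
      (fun k r => computes g [tuple of k :: r :: args n (fun l =>
        e l.+2)]) (e 1) (e 0))).
    by move=> e; rewrite computes_precE thead_args behead_args; exact: iff_refl.
  apply: davis_ext => [e|]; first exact: iff_sym (prim_iter_beta _ _ _ _).
  do 2![apply: davis_ex => /=]; apply: davis_and.
    apply: davis_ex => /=; apply: davis_and.
      by apply: davis_dio; apply: dio_beta; dio.
    exact: (davis_graph_args (fun l => l.+4.+1) 0 IHf).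
  apply: davis_and; first by apply: davis_dio; apply: dio_beta; dio.
  apply: (davis_all (Q := fun e i => exists x x', godel_beta (e 1) (e 0) i x /\
    (godel_beta (e 1) (e 0) i.+1 x' /\
      computes g [tuple of i :: x :: args n (fun l => e l.+4)] x')) 3).
  do 2![apply: davis_ex => /=]; apply: davis_and.
    by apply: davis_dio; apply: dio_beta; dio.
  apply: davis_and; first by apply: davis_dio; apply: dio_beta; dio.
  apply: davis_ext (davis_graph_args (fun l => match l with 0 => 2 | 1 => 1
    | l'.+2 => l'.+4.+3 end) 0 IHg) => e.
  by rewrite !argsS.
- apply: davis_and.
    (* The induction hypothesis concerns an output that is a variable, so the constant 0 is named
       first. *)
    apply: (@davis_ext (fun e => exists z, z = 0 /\ computes f (args n.+1 e) z)).
      by move=> e; rewrite argsS; split=> [[z [->]]//|h]; exists 0.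
    apply: (davis_ex (P := fun e z => z = 0 /\ computes f (args n.+1 e) z)).
    apply: davis_and; first by apply: davis_dio; dio.
    exact: (davis_graph_args (fun l => l.+1) 0 IHf).
  apply: (davis_all (Q := fun e z => exists r,
     computes f [tuple of z :: args n (fun l => e l.+1)] r.+1) 0).
  apply: davis_ex => /=.
  apply: (@davis_ext (fun e => exists r', r' = (e 0).+1 /\
     computes f [tuple of e 1 :: args n (fun l => e l.+3)] r')).
    by move=> e; split=> [[z [->]]//|h]; exists (e 0).+1.
  apply: davis_ex => /=; apply: davis_and; first by apply: davis_dio; dio.
  apply: davis_ext (davis_graph_args (fun l =>
    if l is l'.+1 then l'.+4 else 2) 0 IHf) => e.
  by rewrite argsS.
Qed.

(** * Elimination of the bounded quantifier *)

Definition atom_mod (m : nat) (s : var -> nat) a :=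
  match a with
  | AOne x => s x = 1 %[mod m]
  | AAdd x y z => s x + s y = s z %[mod m]
  | AMul x y z => s x * s y = s z %[mod m]
  | APow x y z => s x ^ s y = s z %[mod m]
  end.

(** Exceeds [b * b] and [b + b], so sums and products of values below [b] stay below every prime
    factor of the moduli. *)
Definition elim_bound b := b * b + 2 * b + 1.

Definition elim_system l b Q M (c U : env) := forall a, List.In a l ->
  (forall v, List.In v (atom_vars a) ->
    match v with
    | inl 0 => True
    | inl i.+1 => c i < b
    | inr j => M %| 'C(U j, b)
    end) /\ atom_mod M (assignment (scons Q c) U) a.

(** The prime divides [U (U - 1) ... (U - b + 1)], hence some factor [U - i] with [i < b]. *)
Lemma prime_bin_modn p U b : prime p -> p %| 'C(U, b) -> U %% p < b.
Proof.
move=> pp pC; case: (ltnP U b) => [|bU]; first exact: leq_ltn_trans (leq_mod _ _).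
have : p %| U ^_ b by rewrite -bin_ffact dvdn_mulr.
rewrite ffact_prod Euclid_dvd_prod // big_orE => /existsP[i /=].
have lib := ltn_ord i; rewrite -eqn_mod_dvd; last by lia.
by move=> /eqP ->; apply: leq_ltn_trans (leq_mod _ _) lib.
Qed.

Lemma coprime_godel_mod_fact N k b : 3 <= N -> k < N -> b <= N ->
  coprime (godel_mod (godel_base N) k) b`!.
Proof.
move=> N3 kN bN; rewrite fact_prod big_seq; elim/big_rec: _ => [|i y];
  first exact: coprimen1.
rewrite mem_index_iota => /andP[i0 ib] h; rewrite coprimeMr h andbT.
rewrite coprime_has_primes ?(ltnW (godel_mod_gt1 N3 kN)) //.
apply/hasP => -[p]; rewrite !mem_primes => /and3P[pp _ pi] /and3P[_ _ pm].
have := godel_mod_prime_gt N3 kN pp pm; have := dvdn_leq i0 pi; lia.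
Qed.

(** Converse direction: [m_k] divides the factor [U - u] of the falling factorial, and dividing by
    [b!], which is coprime to [m_k], preserves this. *)
Lemma godel_mod_dvd_bin N k b U u : 3 <= N -> k < N -> b <= N -> u < b ->
  U = u %[mod godel_mod (godel_base N) k] -> godel_mod (godel_base N) k %| 'C(U, b).
Proof.
move=> N3 kN bN ub Uu; case: (ltnP U b) => [|bU]; first by move/bin_small->.
rewrite -(@Gauss_dvdl _ _ b`!) ?coprime_godel_mod_fact // bin_ffact ffact_prod.
rewrite (bigD1 (Ordinal ub)) //= dvdn_mulr // -eqn_mod_dvd ?Uu //; lia.
Qed.

Lemma modn_prod_godel_mod N n a c : 3 <= N -> n <= N ->
  (forall k, k < n -> a = c %[mod godel_mod (godel_base N) k]) ->
  a = c %[mod \prod_(k < n) godel_mod (godel_base N) k].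
Proof.
move=> N3 nN h; wlog ca : a c h / c <= a.
  by move=> W; case: (leqP c a) => [|/ltnW] /W -> // k /h.
apply/eqP; rewrite eqn_mod_dvd //; apply: prod_godel_mod_dvd => // k kn.
by rewrite -eqn_mod_dvd // h.
Qed.

Lemma list_bound (T : Type) (l : seq T) (f : T -> nat) :
  exists b, forall x, List.In x l -> f x < b.
Proof.
elim: l => [|x l [b hb]]; first by exists 0.
by exists (b + (f x).+1) => y [<-|/hb]; lia.
Qed.

(* All values of [k] are handled by one congruence modulo [M], the product of
   the [m_k] with [k <= x], in which [Q] stands for [k]; that [M] divides
   ['C(U j, b)] forces [U j] below [b] modulo a prime factor of each [m_k]. *)
Lemma bounded_forall_elim l x (c : env) : system_ok false l ->
  (forall k, k <= x -> exists u, system_holds (assignment (scons k c) u) l) <->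
  exists b Q M, [/\ x < b, 1 < b, Q = godel_base (elim_bound b)
    - 1, M = 'C(Q, x.+1) &
     exists U, elim_system l b Q M c U].
Proof.
move=> lok; split=> [h|[b [Q [M [xb b1 eQ eM [U hU]]]]] k kx].
  have : forall k, exists u, k <= x -> system_holds (assignment (scons k c) u) l.
    by move=> k; case: (leqP k x) => [/h[u hu]|_]; [exists u|exists c].
  move=> /choice[u hu].
  (* Bounding the sum over all [k <= x] bounds the value of each occurring variable uniformly in
     [k]. *)
  have [b0 hb0] := list_bound (List.flat_map atom_vars l)
    (fun v => \sum_(k < x.+1) assignment (scons k c) (u k) v).
  pose b := b0 + x + 2; pose N := elim_bound b.
  have N3 : 3 <= N by rewrite /N /elim_bound /b; nia.
  have bN : b <= N by rewrite /N /elim_bound; nia.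
  have xN : x.+1 <= N by apply: leq_trans bN; rewrite /b; lia.
  have hb a v k : List.In a l -> List.In v (atom_vars a) -> k <= x ->
      assignment (scons k c) (u k) v < b.
    move=> al va kx; have lt : k < x.+1 by [].
    have /hb0 : List.In v (List.flat_map atom_vars l) by apply/List.in_flat_map;
      exists a.
    rewrite (bigD1 (Ordinal lt)) //= /b; lia.
  (* The solutions [u k j] for all [k] are merged into a single [U j] by the Chinese remainder
     theorem. *)
  have /choice[U hU] : forall j, exists U, forall k, k < x.+1 ->
      U = u k j %[mod godel_mod (godel_base N) k].
    by move=> j; apply: godel_mod_crt.
  exists b, (godel_base N - 1), ('C(godel_base N - 1, x.+1)); split=> //;
    try by rewrite /b; lia.
  exists U => a al; rewrite bin_godel_base //; split.
    move=> [[|i]|j] va //; first exact: (hb a (inl i.+1) 0).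
    apply: prod_godel_mod_dvd => // k kx.
    apply: godel_mod_dvd_bin (hU j k kx) => //; first exact: leq_trans xN.
    exact: (hb a (inr j) k).
  have E k v : k < x.+1 -> assignment (scons (godel_base N - 1) c) U v =
      assignment (scons k c) (u k) v %[mod godel_mod (godel_base N) k].
    move=> kx; case: v => [[|i]|j] //=; last exact: hU.
    by apply: godel_base_pred_mod => //; apply: leq_trans xN.
  have := lok a al; case: a al => //= [y|y z w|y z w] al _;
    apply: modn_prod_godel_mod => // k kx.
  - by rewrite (E k) //; have /= -> := hu k kx _ al.
  - by rewrite -modnDm !(E k) // modnDm; have /= -> := hu k kx _ al.
  - by rewrite -modnMm !(E k) // modnMm; have /= -> := hu k kx _ al.
set N := elim_bound b in eQ.
have N3 : 3 <= N by rewrite /N /elim_bound; nia.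
have bN : b <= N by rewrite /N /elim_bound; nia.
have kN : k < N by lia.
have m1 := godel_mod_gt1 N3 kN.
set p := pdiv (godel_mod (godel_base N) k).
have pp : prime p := pdiv_prime m1.
have pm : p %| godel_mod (godel_base N) k := pdiv_dvd _.
have pN : N < p := godel_mod_prime_gt N3 kN pp pm.
have pM : p %| M.
  rewrite eM eQ bin_godel_base //; last by lia.
  by rewrite (bigD1 (Ordinal (kx : k < x.+1))) //= dvdn_mulr.
(* Residues of the occurring unknowns are below [b], and [p] exceeds [b * b] and [b + b], so the
   congruences modulo [p] become equalities. *)
exists (fun j => U j %% p) => a al; have [hv ha] := hU a al.
set s := assignment _ _.
have H v : List.In v (atom_vars a) ->
    s v < b /\ assignment (scons Q c) U v = s v %[mod p].
  move=> /hv; case: v => [[|i]|j] //=.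
  - by split; [lia|rewrite /s /= eQ -(modn_dvdm _ pm)
      godel_base_pred_mod // modn_dvdm].
  - move=> MC; split; last by rewrite modn_mod.
    by apply: prime_bin_modn => //; apply: dvdn_trans MC.
have bbN : b * b < p by apply: leq_ltn_trans pN; rewrite /N /elim_bound; lia.
have b2N : b + b < p by apply: leq_ltn_trans pN; rewrite /N /elim_bound; lia.
have bp : b <= p := ltnW (leq_ltn_trans bN pN).
have modp i j : i = j %[mod M] -> i = j %[mod p].
  by move=> e; rewrite -(modn_dvdm _ pM) e modn_dvdm.
have small i j : i < p -> j < p -> i = j %[mod p] -> i = j.
  by move=> ip jp; rewrite !modn_small.
have := lok a al; case: a al hv ha H => //= [y|y z w|y z w] al hv /modp ha H _.
- have [yb ye] := H y (or_introl (erefl _)).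
  by apply: small; [exact: leq_trans bp|exact: prime_gt1|rewrite -ye].
- have [yb ye] := H y (or_introl (erefl _)).
  have [zb ze] := H z (or_intror (or_introl (erefl _))).
  have [wb we] := H w (or_intror (or_intror (or_introl (erefl _)))).
  apply: small; [|exact: leq_trans bp|by rewrite -we -ha -modnDm -ye -ze modnDm].
  by apply: leq_trans b2N; rewrite ltnS leq_add // ltnW.
- have [yb ye] := H y (or_introl (erefl _)).
  have [zb ze] := H z (or_intror (or_introl (erefl _))).
  have [wb we] := H w (or_intror (or_intror (or_introl (erefl _)))).
  apply: small; [|exact: leq_trans bp|by rewrite -we -ha -modnMm -ye -ze modnMm].
  by apply: leq_ltn_trans bbN; apply: leq_mul; apply: ltnW.
Qed.

(** * Divisibility, congruences, binomial coefficients and factorials as Diophantine relations *)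

Lemma dio_dvd b f g : dio_fun b f -> dio_fun b g -> diophantine b (fun e =>
  f e %| g e).
Proof.
apply: (dio_rel2 (Q := fun x y => x %| y)).
apply: (@dio_ext _ (fun e => exists q, e 1 = q * e 0)); last by dio.
by move=> e; split=> [[q ->]|/dvdnP//]; rewrite dvdn_mull.
Qed.

Lemma dio_modn b f g h : dio_fun b f -> dio_fun b g -> dio_fun b h ->
  diophantine b (fun e => f e = g e %[mod h e]).
Proof.
move=> hf hg hh; pose r i := if i is i'.+1 then i'.+3 else 0.
apply: (@dio_ext _ (fun e => exists q q', f e + q * h e = g e + q' * h e)).
  move=> e; split=> [[q [q' E]]|E].
    by have := congr1 (modn^~ (h e)) E;
      rewrite /= !(addnC (f e)) !(addnC (g e)) !modnMDl.
  exists (g e %/ h e), (f e %/ h e).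
  have := divn_eq (f e) (h e); have := divn_eq (g e) (h e); rewrite E.
  by move: (f e %/ h e * h e) (g e %/ h e * h e) (g e %% h e); lia.
have hf2 := dio_rename r hf; have hg2 := dio_rename r hg;
  have hh2 := dio_rename r hh.
do 2![apply: dio_ex => /=].
by apply: dio_eq (dio_funD hf2 (dio_funM _ hh2)) (dio_funD hg2 (dio_funM _ hh2));
  dio.
Qed.

Lemma dio_fun_bin f g : dio_fun true f -> dio_fun true g ->
  dio_fun true (fun e => 'C(f e, g e)).
Proof.
apply: dio_fun2; apply: (@dio_ext _ (fun e => exists q r u, u = (2 ^ e 1).+1 /\
    (u.+1 ^ e 1 = q * u ^ (e 2).+1 + e 0 * u ^ e 2 + r /\ (r < u ^ e 2 /\
      e 0 < u)))).
  move=> e; split=> [[q [r [u [h1 [h2 [h3 h4]]]]]]|/esym/bin_expP].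
    by apply/esym/bin_expP; exists q, r, u.
  by move=> [q [r [u [h1 h2 h3 h4]]]]; exists q, r, u.
by dio.
Qed.

Lemma dio_fun_fact f : dio_fun true f -> dio_fun true (fun e => (f e)`!).
Proof.
move=> hf; apply: (@dio_fun_let _ f (fun _ x => x`!)) => //.
apply: (@dio_ext _ (fun e =>
  (* The threshold for [r] would mention the factorial being defined; its upper bound [n ^ n]
     replaces it. *)
  exists r s, (r = (e 1 ^ e 1).+1 * (e 1 * e 1) + e 1 + 1) /\
    (r ^ e 1 = e 0 * 'C(r, e 1) + s /\ s < 'C(r, e 1)))).
  move=> e; set n := e 1; set r := (n ^ n).+1 * (n * n) + n + 1.
  have hn : n`! <= n ^ n.
    rewrite fact_prod big_add1 big_mkord -[X in _ <= _ ^ X]card_ord -prod_nat_const.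
    by apply: leq_prod => i _.
  have hr : (n`!).+1 * (n * n) + n < r by rewrite /r; nia.
  have E := fact_div_bin hr.
  have C0 : 0 < 'C(r, n) by rewrite bin_gt0; lia.
  split=> [[r' [s [-> [h1 h2]]]]|h].
    by rewrite E h1 divnMDl // divn_small // addn0.
  exists r, (r ^ n %% 'C(r, n)); split=> //; split; last exact: ltn_pmod.
  by rewrite -h E -divn_eq.
do 2![apply: dio_ex => /=]; apply: dio_and; first by dio.
have hC : dio_fun true (fun e => 'C(e 1, e 3)) by apply: dio_fun_bin; dio.
apply: dio_and; last by apply: (dio_lt _ hC); dio.
by apply: (dio_eq _ (dio_funD (dio_funM _ hC) _)); dio.
Qed.

Theorem davis_exponential P : davis P -> diophantine true P.
Proof.
move=> [D [l lok hD] hP].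
apply: (@dio_ext _ (fun e => exists x b Q M, x < b /\ (1 < b /\
   ((elim_bound b)`! * (elim_bound b)`! = Q.+1 /\ ('C(Q, x.+1) = M /\
    exists U, elim_system l b Q M (scons x e) U))))).
  move=> e; rewrite hP.
  have E x : (forall k, k <= x -> D k x e) <->
     (forall k, k <= x -> exists u, system_holds (assignment (scons k (scons x e))
       u) l).
    by split=> h k /h; rewrite -(hD (scons k (scons x e))).
  have G b Q : (elim_bound b)`! * (elim_bound b)`! = Q.+1 <->
    Q = godel_base (elim_bound b) - 1.
    have : 0 < godel_base (elim_bound b) by rewrite muln_gt0 !fact_gt0.
    by rewrite /godel_base; split; lia.
  split=> [[x [b [Q [M [h1 [h2 [/G h3 [h4 h5]]]]]]]]|[x /E]].
    by exists x; apply/E/bounded_forall_elim => //; exists b, Q, M; split.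
  by move=> /(bounded_forall_elim _ _ lok)[b [Q [M [h1 h2 /G h3 h4 h5]]]];
    exists x, b, Q, M.
do 4![apply: dio_ex => /=].
apply: dio_and; first by dio.
apply: dio_and; first by dio.
have hN : dio_fun true (fun e => elim_bound (e 2)) by rewrite /elim_bound; dio.
apply: dio_and.
  by apply: (dio_eq (dio_funM (dio_fun_fact hN) (dio_fun_fact hN))); dio.
apply: dio_and; first by apply: (dio_eq (dio_fun_bin _ _)); dio.
(* [U] is a whole environment and is bound through [interleave]: [M], [Q], [b], [x], at indices 0 to
   3, move to 1, 3, 5, 7. *)
apply: (@dio_ext _ (fun e =>
  exists U, elim_system l (interleave U e 5) (interleave U e 3) (interleave U e 1)
    (scons (interleave U e 7) (fun i => interleave U e (i.+4).*2.+1)) (fun j =>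
      interleave U e j.*2))).
  move=> e.
  have E1 U : (fun i => interleave U e (i.+4).*2.+1) = (fun i => e i.+4).
    by apply: funext => i; rewrite interleave_odd.
  have E2 U : (fun j => interleave U e j.*2) = U by apply: funext => j;
    rewrite interleave_even.
  by split=> -[U h]; exists U; move: h; rewrite E1 E2.
apply: (dio_exs (P := fun e => elim_system l (e 5) (e 3) (e 1)
    (scons (e 7) (fun i => e (i.+4).*2.+1)) (fun j => e j.*2))).
pose w (v : var) := match v with inl 0 => 3 | inl 1 => 7 | inl i.+2 => (i.+4).*2.+1
  | inr j => j.*2 end.
have wE e v : assignment (scons (e 3) (scons (e 7) (fun i =>
  e (i.+4).*2.+1))) (fun j => e j.*2) v
   = e (w v) by case: v => [[|[|]]|].
apply: dio_all_in => a al; apply: dio_and.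
  apply: dio_all_in => -[[|[|i]]|j] _ /=; try by dio.
  - by apply: dio_ext (dio_true _).
  - by apply: dio_dvd; [|apply: dio_fun_bin]; dio.
have := lok a al; case: a al => //= [y|y z t|y z t] al _.
- apply: dio_ext (dio_modn (dio_funV _ (w y)) (dio_funC _ 1) (dio_funV _ 1)) => e.
  by rewrite wE.
- apply: dio_ext (dio_modn (dio_funD (dio_funV _ (w y)) (dio_funV _ (w z)))
    (dio_funV _ (w t))
    (dio_funV _ 1)) => e.
  by rewrite !wE.
- apply: dio_ext (dio_modn (dio_funM (dio_funV _ (w y)) (dio_funV _ (w z)))
    (dio_funV _ (w t))
    (dio_funV _ 1)) => e.
  by rewrite !wE.
Qed.

(** * Codes of formulas *)

(** Doubling clears the denominator of the triangular number, which makes Cantor pairing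
    Diophantine. *)
Lemma pair_codeE a b : 2 * pair_code a b = 2 * b + (a + b) * (a + b).+1.
Proof.
rewrite /pair_code /Cantor.to_nat; set s := nat_rec _ _ _.
have E n : 2 * s n = n * n.+1 by elim: n => // n IH; rewrite /s /= -/(s n); lia.
by have := E (b + a); rewrite -![Nat.add _ _]/(_ + _)%N; lia.
Qed.

Lemma dio_fun_pair b f g : dio_fun b f -> dio_fun b g ->
  dio_fun b (fun e => pair_code (f e) (g e)).
Proof.
apply: dio_fun2; apply: (@dio_ext _ (fun e =>
  2 * e 0 = 2 * e 2 + (e 1 + e 2) * (e 1 + e 2).+1)).
  by move=> e; rewrite -pair_codeE; split; lia.
by dio.
Qed.

(** Code of [1] scaled by [a]: the integers [a] and [1] have codes [2 * a] and [2]. Such a numeral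
    has fixed depth, so its code involves no recursion on [a]. *)
Definition numeral_code a :=
  pair_code 5 (pair_code (pair_code (2 * a) 2) (pair_code 2 0)).

Definition instance_code i j a c :=
  pair_code 3 (pair_code c (pair_code 3 (pair_code
    (pair_code 1 (pair_code (pair_code 0 i) (numeral_code a)))
    (pair_code 1 (pair_code (pair_code 0 j) (numeral_code c)))))).

Lemma dio_fun_instance b i j : dio_fun b (fun e => instance_code i j (e 0) (e 1)).
Proof. by rewrite /instance_code /numeral_code; do ![apply: dio_fun_pair]; dio. Qed.

(** * Logarithmic formulas *)

Local Open Scope ring_scope.

Definition numeral n (a : nat) : term n := TScale (a%:Z%:~R) TOne.
Arguments numeral : clear implicits.

(** Conjoined equations stand in for substitution, so the code of an instance is an explicit term in
    the code of [F]. *)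
Definition instance n (i j : 'I_n) (F : formula n) a b :=
  FAnd F (FAnd (FEq (TVar i) (numeral n a)) (FEq (TVar j) (numeral n b))).

Lemma formula_code_instance n (i j : 'I_n) F a :
  formula_code (instance i j F a (formula_code F)) =
  instance_code i j a (formula_code F).
Proof.
by rewrite /instance_code /numeral_code /= /rat_code !numq_int !denq_int /= -!mul2n.
Qed.

Definition conj_formulas n (l : seq (formula n)) :=
  foldr (@FAnd n) (FEq TZero TZero) l.

Section Log.
Variables (R : realType) (lg : R -> R).
Hypothesis hlg : forall x : R, 0 < x -> lg x = ln x.

Lemma holds_conj n (x : 'I_n -> R) l :
  holds lg x (conj_formulas l) <-> forall F, List.In F l -> holds lg x F.
Proof.
elim: l => [|F l IH] /=; first by split.
rewrite IH; split=> [[h1 h2] G [<-//|/h2//]|h].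
by split=> [|G Gl]; apply: h; [left|right].
Qed.

Lemma ln_nat_mul (a b c : nat) : (0 < a)%N -> (0 < b)%N -> (0 < c)%N ->
  ln (a%:R : R) + ln b%:R = ln c%:R <-> (a * b)%N = c.
Proof.
move=> a0 b0 c0; rewrite -lnM ?posrE ?ltr0n // -natrM; split=> [|->//].
move/ln_inj; rewrite !posrE !ltr0n muln_gt0 a0 b0 => /(_ isT c0) /eqP.
by rewrite eqr_nat => /eqP.
Qed.

Lemma lnln_nat_pow (a b c : nat) : (1 < a)%N -> (0 < b)%N -> (1 < c)%N ->
  ln (b%:R : R) + ln (ln a%:R) = ln (ln c%:R) <-> (a ^ b)%N = c.
Proof.
move=> a1 b0 c1.
have la : 0 < ln (a%:R : R) by rewrite ln_gt0 // ltr1n.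
have lc : 0 < ln (c%:R : R) by rewrite ln_gt0 // ltr1n.
have ab0 : (0 < a ^ b)%N by rewrite expn_gt0; lia.
rewrite -lnM ?posrE ?ltr0n // mulr_natl -lnXn ?ltr0n; last by lia.
rewrite -natrX; split=> [/ln_inj|->//]; rewrite !posrE lc natrX lnXn ?ltr0n;
  last by lia.
rewrite pmulrn_lgt0 // la => /(_ isT isT).
rewrite -lnXn ?ltr0n; last by lia.
rewrite -natrX => /ln_inj; rewrite !posrE !ltr0n ab0 => /(_ isT (ltnW c1)) /eqP.
by rewrite eqr_nat => /eqP.
Qed.

(** Zero factors are treated apart, because only logarithms of positive numbers have a prescribed
    value. *)
Definition mul_formula n (x y z : term n) :=
  FOr (FAnd (FOr (FEq x TZero) (FEq y TZero)) (FEq z TZero))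
      (FAnd (FAnd (FLt TZero x) (FLt TZero y))
            (FAnd (FLt TZero z) (FEq (TAdd (TLog x) (TLog y)) (TLog z)))).

(** The iterated logarithm is used only for a base and a value above 1; the other disjuncts cover
    exponent 0 (with [0 ^ 0 = 1]), base 1 and base 0. *)
Definition pow_formula n (x y z : term n) :=
  FOr (FAnd (FOr (FEq y TZero) (FEq x TOne)) (FEq z TOne))
  (FOr (FAnd (FLt TZero y) (FAnd (FEq x TZero) (FEq z TZero)))
       (FAnd (FAnd (FLt TOne x) (FLt TZero y))
             (FAnd (FLt TOne z)
                   (FEq (TAdd (TLog y) (TLog (TLog x))) (TLog (TLog z)))))).

Lemma natr_eq1 (a : nat) : (a%:R : R) = 1 <-> a = 1%N.
Proof. by split=> [/eqP|->//]; rewrite pnatr_eq1 => /eqP. Qed.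

Lemma natr_eq0 (a : nat) : (a%:R : R) = 0 <-> a = 0%N.
Proof. by split=> [/eqP|->//]; rewrite pnatr_eq0 => /eqP. Qed.

Lemma holds_mul_formula n (v : 'I_n -> R) (x y z : term n) (a b c : nat) :
  teval lg v x = a%:R -> teval lg v y = b%:R -> teval lg v z = c%:R ->
  holds lg v (mul_formula x y z) <-> (a * b)%N = c.
Proof.
rewrite /= => -> -> ->; rewrite !ltr0n !natr_eq0.
split=> [[[[->|->] ->]//|[[a0 b0] [c0]]]|h].
- by rewrite muln0.
- by rewrite !hlg ?ltr0n // ln_nat_mul.
have [a0|a0] := posnP a; first by left; split; [left|rewrite -h a0].
have [b0|b0] := posnP b; first by left; split; [right|rewrite -h b0 muln0].
have c0 : (0 < c)%N by rewrite -h muln_gt0 a0.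
by right; do !split=> //; rewrite !hlg ?ltr0n // ln_nat_mul.
Qed.

Lemma holds_pow_formula n (v : 'I_n -> R) (x y z : term n) (a b c : nat) :
  teval lg v x = a%:R -> teval lg v y = b%:R -> teval lg v z = c%:R ->
  holds lg v (pow_formula x y z) <-> (a ^ b)%N = c.
Proof.
rewrite /= => -> -> ->; rewrite !ltr0n !ltr1n !natr_eq0 !natr_eq1.
have LL k : (1 < k)%N -> lg (lg k%:R) = ln (ln k%:R).
  by move=> k1; rewrite (@hlg k%:R) ?ltr0n ?(ltnW k1) // hlg // ln_gt0 // ltr1n.
split=> [[[[->|->] ->]|[[b0 [-> ->]]|[[a1 b0] [c1]]]]|h].
- by [].
- by rewrite exp1n.
- by rewrite exp0n.
- by rewrite (hlg (x := b%:R)) ?ltr0n // !LL // lnln_nat_pow.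
have [b0|b0] := posnP b; first by left; split; [left|rewrite -h b0].
have [a0|a0] := posnP a; first by right; left; do !split=> //; rewrite -h a0 exp0n.
have [a1|a1] := eqVneq a 1%N; first by left; split; [right|rewrite -h a1 exp1n].
have a2 : (1 < a)%N by lia.
have c1 : (1 < c)%N by rewrite -h -(expn0 a) ltn_exp2l.
right; right; do !split=> //.
by rewrite (hlg (x := b%:R)) ?ltr0n // !LL // lnln_nat_pow.
Qed.

Definition var_index (v : var) : nat :=
  match v with inl i => i.*2 | inr j => j.*2.+1 end.
Definition index_var (i : nat) : var := if odd i then inr i./2 else inl i./2.

Lemma var_indexK : cancel var_index index_var.
Proof.
by case=> i; rewrite /index_var /= odd_double /= ?uphalf_double ?doubleK.
Qed.

Definition tvar n (v : var) : term n.+1 := TVar (inord (var_index v)).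

Definition atom_formula n (a : atom) : formula n.+1 :=
  match a with
  | AOne x => FEq (tvar n x) TOne
  | AAdd x y z => FEq (TAdd (tvar n x) (tvar n y)) (tvar n z)
  | AMul x y z => mul_formula (tvar n x) (tvar n y) (tvar n z)
  | APow x y z => pow_formula (tvar n x) (tvar n y) (tvar n z)
  end.

Lemma holds_atom_formula n (x : 'I_n.+1 -> R) s a :
  (forall v, List.In v (atom_vars a) -> x (inord (var_index v)) = (s v)%:R) ->
  holds lg x (atom_formula n a) <-> atom_holds s a.
Proof.
case: a => [y|y z t|y z t|y z t] h.
- by rewrite /= h ?natr_eq1; last by left.
- rewrite /= !h /=; try by tauto.
  by rewrite -natrD; split=> [/eqP|->//]; rewrite eqr_nat => /eqP.
- by apply: holds_mul_formula; rewrite /= h /=; tauto.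
- by apply: holds_pow_formula; rewrite /= h /=; tauto.
Qed.

(** Variables range over the integers, so nonnegativity is imposed on each of them. *)
Definition system_formula n (l : seq atom) : formula n.+1 :=
  FAnd (conj_formulas [seq FNot (FLt (TVar i) TZero) | i <- enum 'I_n.+1])
       (conj_formulas (map (atom_formula n) l)).

Lemma mem_In (T : eqType) (x : T) s : x \in s -> List.In x s.
Proof. by elim: s => //= y s IH; rewrite inE => /orP[/eqP->|/IH]; [left|right]. Qed.

(* Parameters 0 and 1 are the integer variables 0 and 2: see [var_index]. *)
Lemma exponential_log (P : env -> Prop) : diophantine true P ->
  exists N (F : formula N.+3), forall a b : nat,
    (exists x : 'I_N.+3 -> int, [/\ holds lg (fun i => (x i)%:~R) F,
       x (inord 0) = a & x (inord 2) = b]) <->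
    exists e, [/\ e 0%N = a, e 1%N = b & P e].
Proof.
move=> [l _ hP]; have [N hN] := list_bound (List.flat_map atom_vars l) var_index.
have {}hN c v : List.In c l -> List.In v (atom_vars c) -> (var_index v < N)%N.
  by move=> cl vc; apply: hN; apply/List.in_flat_map; exists c.
(* Three variables beyond the bound [N] guarantee that indices 0 and 2 exist and that [inord] never
   falls back on its default. *)
exists N, (system_formula N.+2 l) => a b; split.
  move=> [x [[/holds_conj hx /holds_conj hl] xa xb]].
  have x0 i : x i = `|x i|%N.
    rewrite gez0_abs // leNgt; apply/negP => xi.
    apply: (hx (FNot (FLt (TVar i) TZero))).
      by apply: (List.in_map (fun i => FNot (FLt (TVar i) TZero))); apply: mem_In;
        rewrite mem_enum.
    by rewrite /= ltrz0.
  exists (fun i => `|x (inord i.*2)|%N); split; rewrite /= ?xa ?xb //.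
  apply/hP; exists (fun j => `|x (inord j.*2.+1)|%N) => c cl.
  have := hl _ (List.in_map (atom_formula N.+2) _ _ cl).
  rewrite holds_atom_formula; first by apply.
  by move=> v _; rewrite x0 -pmulrn; case: v.
move=> [e [ea eb /hP[u hu]]].
exists (fun i => (assignment e u (index_var i))%:Z).
have E v : (var_index v < N.+3)%N -> index_var (inord (var_index v) : 'I_N.+3) = v.
  by move=> vN; rewrite inordK // var_indexK.
split; last 2 first.
- by rewrite (E (inl 0%N)) /= ?ea.
- by rewrite (E (inl 1%N)) /= ?eb.
split; apply/holds_conj.
  by move=> F /List.in_map_iff[i [<- _]] /=; rewrite ltrz0.
move=> F /List.in_map_iff[c [<- cl]].
apply/(holds_atom_formula (s := assignment e u)); last exact: hu.
by move=> v vc; rewrite E //; have := hN c v cl vc; lia.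
Qed.

End Log.

Theorem proposition5p1 (R : realType) (lg : R -> R)
    (hlg : forall x : R, 0 < x -> lg x = ln x) :
  ~ decidable_sentences (fun n (F : formula n) => sentence_true lg F).
Proof.
move=> [f hf].
(* Here [e 0] is a number of variables and [e 1] the code of a formula, which is instantiated at
   these two numbers. *)
pose P (e : env) := computes f [tuple e 0%N; instance_code 0 2 (e 0%N) (e 1%N)] 0%N.
have nP : davis P.
  apply: (@davis_ext (fun e => exists m, instance_code 0 2 (e 0%N) (e 1%N) = m /\
     computes f [tuple e 0%N; m] 0%N)).
    by move=> e; split=> [[m [<-]]//|h]; exists (instance_code 0 2 (e 0%N) (e 1%N)).
  apply: davis_ex => /=; apply: davis_and.
    apply: davis_dio.
    exact: (dio_rename (fun i => match i with 0 => 0 | 1 => 1 | 2 => 2 | _ =>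
      0 end) (dio_fun_instance false 0 2)).
  apply: (@davis_ext (fun e => exists z, z = 0%N /\ computes f [tuple e 1%N;
    e 0%N] z)).
    by move=> e; split=> [[m [->]]//|h]; exists 0%N.
  apply: davis_ex => /=; apply: davis_and; first by apply: davis_dio; dio.
  apply: davis_ext (davis_graph_args
    (fun i => if i is 0 then 2 else 1) 0 (recfun_davis f)) => e.
  have -> // : [tuple e 2;
    e 1%N] = args 2 (e \o (fun i => if i is 0 then 2 else 1)).
  by apply: eq_from_tnth => -[[|[|i]] hi] //; rewrite tnth_mktuple.
have [N [F hF]] := exponential_log hlg (davis_exponential nP).
pose c := formula_code F; pose G := instance (inord 0) (inord 2) F N.+3 c.
have eG : formula_code G = instance_code 0 2 N.+3 c.
  by rewrite formula_code_instance !inordK.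
(* Fixed point: [G] holds exactly when the algorithm rejects [G], so either truth value of [G] gives
   a contradiction. *)
have hG : sentence_true lg G <-> computes f [tuple N.+3; formula_code G] 0%N.
  have numE x a : teval lg x (numeral N.+3 a) = a%:Z%:~R :> R.
    by rewrite /= ratr_int mulr1.
  split=> [[x [hx [h1 h2]]]|h].
    have [|e [ea eb]] := (hF N.+3 c).1; last by rewrite /P ea eb eG.
    by exists x; split=> //; apply: (@intr_inj R);
      [exact: etrans h1 (numE _ _)|exact: etrans h2 (numE _ _)].
  have [|x [hx xa xb]] := (hF N.+3 c).2.
    exists (fun i => if i is 0 then N.+3 else c); split=> //.
    by rewrite /P -eG.
  exists x; split=> //.
  by split; apply: (etrans _ (esym (numE _ _))); rewrite /= ?xa ?xb.
have [h1 h0] := hf _ G.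
have [S|S] := pselect (sentence_true lg G).
  by have := computes_fun (h1 S) (hG.1 S).
exact: S (hG.2 (h0 S)).
Qed.
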